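(* Let $(b_n)_{n\ge1}$ be a nondecreasing sequence of positive real numbers converging to $+\infty$ and let $(a_n)_{n\ge1}$ be a sequence of real numbers. If $\liminf_{n\to+\infty}\sum_{k=1}^n\frac{a_k}{b_k}\in\mathbb{R}$ (i.e. this lower limit is finite), then $$\liminf_{n\to+\infty}\frac{1}{b_n}\sum_{k=1}^n a_k\le 0.$$
   Context: The lower limits are a priori taken in $[-\infty,+\infty]$. *)

(* Defs.v *)
From mathcomp Require Export all_boot all_order all_algebra.
From mathcomp Require Export all_classical all_reals all_analysis.
Export numFieldNormedType.Exports.

(* Main.v *)
(** Abel summation: with [S n] the partial sums of [a k / b k] and [A n] those
    of [a k], one has [A n - b n * S n = - \sum_(1 <= k < n) (b k.+1 - b k) * S k],
    the nonnegative weights adding up to roughly [b n]. As [S k] is eventually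
    larger than its lower limit [l] minus [d], [A n <= b n * (S n - l + d) + O(1)].
    If [A n / b n] were eventually larger than [e = 3d > 0], then [S n] would
    eventually be at least [l + d], a contradiction. *)
Require Import Defs.
From mathcomp Require Import all_boot all_order all_algebra.
From mathcomp Require Import all_classical all_reals all_analysis.
From mathcomp Require Import ring lra.
Import Order.TTheory GRing.Theory Num.Theory.
Import numFieldNormedType.Exports.
Local Open Scope classical_set_scope.
Local Open Scope ring_scope.

(** The lower limit is the supremum of the tail infima, so some tail infimum already exceeds [x]. *)
Lemma lt_limn_einf_near (R : realType) (u : nat -> \bar R) (x : \bar R) :
  (x < limn_einf u)%E -> \forall n \near \oo, (x < u n)%E.
Proof.
rewrite limn_einf_lim (cvg_lim _ (@cvg_einfs_sup _ u))// => /ereal_sup_gt.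
move=> [_ [N _ <-] xN]; exists N => // n /= Nn.
by apply: (lt_le_trans xN); apply: ereal_inf_lbound; exists n.
Qed.

Lemma limn_einf_ge_near (R : realType) (u : nat -> \bar R) (x : \bar R) :
  (\forall n \near \oo, (x <= u n)%E) -> (x <= limn_einf u)%E.
Proof.
move=> [N _ xu]; rewrite limn_einf_lim (cvg_lim _ (@cvg_einfs_sup _ u))//.
apply: (@le_trans _ _ (einfs u N)); last by apply: ereal_sup_ubound; exists N.
by apply: le_ereal_inf_tmp => _ [n /= Nn <-]; exact: xu.
Qed.

(** From [n] to [n.+1] the left side changes by exactly [- (b n.+1 - b n) * S n], which is at most
    [- t * (b n.+1 - b n)]; these bounds telescope. *)
Lemma abel_sum_le (R : realFieldType) (b a : nat -> R) (t : R) (M : nat) :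
  let S n := \sum_(1 <= k < n.+1) a k / b k in
  let A n := \sum_(1 <= k < n.+1) a k in
  (forall n, (M <= n)%N -> 0 < b n) ->
  (forall n, (M <= n)%N -> b n <= b n.+1) ->
  (forall n, (M <= n)%N -> t <= S n) ->
  forall n, (M <= n)%N ->
    A n - b n * S n <= A M - b M * S M - t * (b n - b M).
Proof.
move=> S A b_gt0 b_le tS n; elim: n => [|n IHn].
  by rewrite leqn0 => /eqP ->; lra.
rewrite leq_eqVlt => /predU1P[<-|]; first lra.
rewrite ltnS => Mn; move: (IHn Mn) (b_le n Mn) (tS n Mn) => {}IHn bn tSn.
have bS0 : b n.+1 != 0 by rewrite gt_eqF// b_gt0// leqW.
have AS : A n.+1 = A n + a n.+1 by rewrite /A big_nat_recr.
have SS : b n.+1 * S n.+1 = b n.+1 * S n + a n.+1.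
  by rewrite /S big_nat_recr//= mulrDr mulrCA divff// mulr1.
by rewrite AS SS; nra.
Qed.

Theorem lemma1 (R : realType) (b a : nat -> R)
  (b_pos : forall n, (1 <= n)%N -> 0 < b n)
  (b_nondecreasing : forall m n, (1 <= m)%N -> (m <= n)%N -> b m <= b n)
  (b_cvg : b n @[n --> \oo] --> +oo)
  (liminf_fin :
    limn_einf (fun n => (\sum_(1 <= k < n.+1) a k / b k)%:E) \is a fin_num) :
  (limn_einf (fun n => ((b n)^-1 * \sum_(1 <= k < n.+1) a k)%:E) <= 0)%E.
Proof.
move: liminf_fin.
set S := fun n => \sum_(1 <= k < n.+1) a k / b k.
set A := fun n => \sum_(1 <= k < n.+1) a k.
move=> /fineK; set l := fine _ => lS.
apply/lee_addgt0Pr => e e_gt0; rewrite add0e leNgt; apply/negP.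
move=> /lt_limn_einf_near eA.
(* One [d] is lost in bounding [S] below, one absorbs the constant [K], and one remains as the gap
   above [l]. *)
pose d := e / 3.
have d_gt0 : 0 < d by rewrite divr_gt0.
have : ((l - d)%:E < limn_einf (fun n => (S n)%:E))%E.
  by rewrite -lS lte_fin ltrBlDr ltrDl.
move=> /lt_limn_einf_near[M0 _ tS].
(* The successor ensures [1 <= M]: nothing is assumed about [b 0]. *)
pose M := M0.+1.
have Abel n : (M <= n)%N ->
    A n - b n * S n <= A M - b M * S M - (l - d) * (b n - b M).
  apply: abel_sum_le => k Mk.
  - by apply: b_pos; apply: leq_trans Mk.
  - by apply: b_nondecreasing => //; apply: leq_trans Mk.
  - by apply: ltW; rewrite -lte_fin; apply: tS; apply: ltnW.
(* With this [K], [Abel] reads [A n <= b n * (S n - l + d) + K]. *)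
pose K := A M - b M * S M + (l - d) * b M.
suff : ((l + d)%:E <= limn_einf (fun n => (S n)%:E))%E.
  by rewrite -lS lee_fin gerDl leNgt d_gt0.
apply: limn_einf_ge_near.
move/cvgryPge: b_cvg => /(_ (K / d)) bK.
near=> n.
have Mn : (M <= n)%N by near: n; exists M.
have b_gt0 : 0 < b n by apply: b_pos; apply: leq_trans Mn.
have Kd : K <= b n * d by rewrite -ler_pdivrMr//; near: n.
have eAn : e * b n < A n.
  rewrite mulrC -ltr_pdivlMl// -lte_fin; near: n; exact: eA.
have := Abel n Mn; rewrite lee_fin -(ler_pM2l b_gt0).
have e3 : e = 3 * d by rewrite /d; field.
(* Here [3 * d * b n < A n <= b n * (S n - l + d) + d * b n], whence [b n * (l + d) < b n * S n]. *)
by move: Kd eAn; rewrite e3 /K; nra.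
Unshelve. all: by end_near.
Qed.
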